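(* Let $(\lambda_n)_{n\ge1}$ be a sequence of positive real numbers, let $\Lambda_n=\sum_{k=1}^n\lambda_k$, and let $A=(a_{n,k})_{n,k\ge1}$ be the weighted mean matrix given by $a_{n,k}=\lambda_k/\Lambda_n$ for $1\le k\le n$ and $a_{n,k}=0$ for $k>n$. Let $0<L<2$. Then $\|A\|_{2,2}\le 2/(2-L)$ if for every integer $n\ge1$ the following condition is satisfied: $$\frac{\Lambda_{n+1}}{\lambda_{n+1}}-\frac{\Lambda_n}{\lambda_n}\le L+\frac{L^2}{4}\cdot\frac{1+\frac L2}{1-\frac L2}\cdot\frac{1}{\frac{\Lambda_{n+1}}{\lambda_{n+1}}+\frac L2}.$$
   Context: $l^2$ is the Hilbert space of complex sequences $\mathbf{x}=(x_n)_{n\ge1}$ with $\|\mathbf{x}\|_2=(\sum_{n=1}^\infty|x_n|^2)^{1/2}<\infty$. For a matrix $C=(c_{n,k})_{n,k\ge 1}$ acting by $(C\mathbf{x})_n=\sum_{k=1}^\infty c_{n,k}x_k$, the operator norm is $\|C\|_{2,2}=\sup_{\|\mathbf{x}\|_2=1}\|C\mathbf{x}\|_2$. *)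

(* Defs.v *)
From HB Require Import structures.
From mathcomp Require Import all_boot all_order all_algebra.
From mathcomp Require Import all_classical all_reals all_analysis.
From mathcomp Require Import complex.
Set Implicit Arguments.
Unset Strict Implicit.
Unset Printing Implicit Defensive.
Import Order.TTheory GRing.Theory Num.Theory.
Import numFieldNormedType.Exports.
Local Open Scope classical_set_scope.
Local Open Scope ring_scope.
Local Open Scope complex_scope.

(* All sequences and matrices are indexed from 0: the index n : nat stands for
   the (n+1)-st term of a sequence indexed by the positive integers. *)

(* R[i] declared at this type carries the topology of its norm `|z|. *)
Definition Cplx (R : realType) : numClosedFieldType := R[i].

(* complex.Re `|z| is the modulus of z as an element of R;
   l2norm x = +oo exactly when x is not in l^2. *)
Definition l2norm (R : realType) (x : nat -> Cplx R) : \bar R :=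
  ((\sum_(0 <= n <oo) ((complex.Re `|x n|) ^+ 2)%:E) `^ 2^-1)%E.

Definition mxterm (R : realType) (C : nat -> nat -> Cplx R) (x : nat -> Cplx R)
  (n k : nat) : Cplx R := C n k * x k.

Definition mxact (R : realType) (C : nat -> nat -> Cplx R)
  (x : nat -> Cplx R) (n : nat) : Cplx R :=
  limn (series (mxterm C x n)).

(* The value is +oo when some series defining (C x)_n diverges: limn would
   otherwise return an arbitrary default value there. *)
Definition mxact_l2norm (R : realType) (C : nat -> nat -> Cplx R)
  (x : nat -> Cplx R) : \bar R :=
  if `[< forall n, cvgn (series (mxterm C x n)) >] then l2norm (mxact C x)
  else +oo%E.

Definition opnorm22 (R : realType) (C : nat -> nat -> Cplx R) : \bar R :=
  ereal_sup [set mxact_l2norm C x | x in [set x | l2norm x = 1%E]].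

Definition partial_sum (R : realType) (lam : nat -> R) (n : nat) : R :=
  \sum_(0 <= k < n.+1) lam k.

Definition weighted_mean_mx (R : realType) (lam : nat -> R) (n k : nat) :
    Cplx R :=
  if (k <= n)%N then (lam k / partial_sum lam n)%:C else 0.

(* Main.v *)
Require Import Defs.
From HB Require Import structures.
From mathcomp Require Import all_boot all_order all_algebra.
From mathcomp Require Import all_classical all_reals all_analysis.
From mathcomp Require Import complex.
From mathcomp Require Import ring lra.
Import Order.TTheory GRing.Theory Num.Theory.
Import numFieldNormedType.Exports.
Local Open Scope ring_scope.

(** Write [h = L / 2], [c = 1 - h] (so that the claimed bound is [1 / c]),
    [b_n = Lambda_n / lambda_n], and let [y_n] be the weighted means of [x_n].
    The means determine the sequence through
      [x_n = b_n y_n - (b_n - 1) y_(n-1)]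
    ([weighted_mean_rec]), so the goal [c^2 \sum |y_n|^2 <= \sum |x_n|^2] is a
    lower bound for a quadratic form in the [y_n] that couples only neighbours.
    It is proved by telescoping: one looks for nonnegative weights [v_n] with
      [c^2 y_n^2 + v_n y_n^2 <= x_n^2 + v_(n-1) y_(n-1)^2].

    The choice [v_n = c b_n + h - c^2] works exactly under the growth
    condition.  With it the coefficient of [y_n^2] in the step inequality factors,
    [b^2 - (c b + h) = (b - 1) (b + h)] for [b = b_n]; completing the square,
    the difference of the two sides becomes a perfect square plus a multiple of
    [v_(n-1) - (b_n - 1) (c b_n + h) / (b_n + h)] ([energy_step]), and Euclidean
    division in [b_n] turns the nonnegativity of this last quantity into the
    hypothesis on [b_n - b_(n-1)] ([weight_step]).  At the first index
    [b_1 = 1] and [v_1 = 1 - c^2], so the telescoping starts with an equality,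
    and [b_n >= 1] gives [v_n >= 0] at the end ([weighted_mean_l2]).

    As the matrix is real, a complex sequence is treated by applying this to
    its real and imaginary parts. *)

(** * The quadratic inequality behind one telescoping step *)

(** With [c = 1 - h], Euclidean division by [b + h] gives
    [(b - 1) (c b + h) / (b + h) = c b + h - c^2 - 2 h c - h^2 (1 + h) / (b + h)],
    so the conclusion is the growth condition multiplied by [c].  Here [b] and
    [a] are consecutive ratios, [b] being the later one. *)
Lemma weight_step (R : realFieldType) (h a b : R) :
  0 < h -> h < 1 -> 1 <= b ->
  b - a <= h *+ 2 + h ^+ 2 * ((1 + h) / (1 - h)) / (b + h) ->
  (b - 1) * (b * (1 - h) + h) / (b + h) <= a * (1 - h) + h - (1 - h) ^+ 2.
Proof.
move=> h0 h1 b1 hyp.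
have bh : 0 < b + h by lra.
have c0 : 0 < 1 - h by lra.
have := ler_wpM2r (ltW c0) hyp.
set e := (X in _ <= X) => he.
have -> : (b - 1) * (b * (1 - h) + h) / (b + h)
   = b * (1 - h) + h - (1 - h) ^+ 2 - e.
  by rewrite /e; field; rewrite !gt_eqF.
lra.
Qed.

(** For the least admissible [v] the difference of the two sides is the square
    [(b - 1) / (b + h) * ((b + h) y - b z)^2]. *)
Lemma energy_step (R : realFieldType) (h b v y z : R) :
  0 < h -> 1 <= b ->
  (b - 1) * (b * (1 - h) + h) / (b + h) <= v ->
  (b * (1 - h) + h) * y ^+ 2 <= (b * y - (b - 1) * z) ^+ 2 + v * z ^+ 2.
Proof.
move=> h0 b1 hv.
have bh : 0 < b + h by lra.
have sq : 0 <= (b - 1) / (b + h) * ((b + h) * y - b * z) ^+ 2.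
  by apply: mulr_ge0 (sqr_ge0 _); apply: divr_ge0; lra.
have := ler_wpM2r (sqr_ge0 z) hv.
have -> : (b * y - (b - 1) * z) ^+ 2 = (b * (1 - h) + h) * y ^+ 2
   + (b - 1) / (b + h) * ((b + h) * y - b * z) ^+ 2
   - (b - 1) * (b * (1 - h) + h) / (b + h) * z ^+ 2.
  by field; rewrite gt_eqF.
lra.
Qed.

(** * Weighted means of real sequences *)

Definition weighted_mean {R : realType} (lam u : nat -> R) (n : nat) : R :=
  (\sum_(0 <= k < n.+1) lam k * u k) / partial_sum lam n.

Definition sum_ratio {R : realType} (lam : nat -> R) (n : nat) : R :=
  partial_sum lam n / lam n.

(** The bound [L] on the increments corresponds to [h = L / 2]. *)
Definition slow_ratio {R : realType} (lam : nat -> R) (h : R) : Prop :=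
  forall n, sum_ratio lam n.+1 - sum_ratio lam n
    <= h *+ 2 + h ^+ 2 * ((1 + h) / (1 - h)) / (sum_ratio lam n.+1 + h).

Lemma partial_sumS (R : realType) (lam : nat -> R) n :
  partial_sum lam n.+1 = partial_sum lam n + lam n.+1.
Proof. by rewrite /partial_sum big_nat_recr. Qed.

Lemma le_partial_sum (R : realType) (lam : nat -> R) n :
  (forall n, 0 < lam n) -> lam n <= partial_sum lam n.
Proof.
move=> lam_gt0; rewrite /partial_sum big_nat_recr //= lerDr.
by apply: sumr_ge0 => i _; apply: ltW.
Qed.

Lemma sum_ratio_ge1 (R : realType) (lam : nat -> R) n :
  (forall n, 0 < lam n) -> 1 <= sum_ratio lam n.
Proof.
by move=> lam_gt0; rewrite /sum_ratio ler_pdivlMr // mul1r le_partial_sum.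
Qed.

Lemma weighted_mean0 (R : realType) (lam u : nat -> R) :
  0 < lam 0%N -> weighted_mean lam u 0 = u 0%N.
Proof.
move=> lam0; rewrite /weighted_mean /partial_sum !big_nat1.
by rewrite mulrC mulKf // gt_eqF.
Qed.

Lemma weighted_mean_rec (R : realType) (lam u : nat -> R) n :
  (forall n, 0 < lam n) ->
  sum_ratio lam n.+1 * weighted_mean lam u n.+1
    - (sum_ratio lam n.+1 - 1) * weighted_mean lam u n = u n.+1.
Proof.
move=> lam_gt0; rewrite /sum_ratio /weighted_mean.
have P0 := lt_le_trans (lam_gt0 n) (le_partial_sum _ lam n lam_gt0).
have P1 := lt_le_trans (lam_gt0 n.+1) (le_partial_sum _ lam n.+1 lam_gt0).
rewrite big_nat_recr //= partial_sumS in P1 *; field.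
by rewrite !gt_eqF.
Qed.

(** The telescoped inequality; the second summand on the left is the weight
    [v_n] times the square of the last mean. *)
Lemma weighted_mean_energy (R : realType) (lam u : nat -> R) (h : R) n :
  (forall n, 0 < lam n) -> 0 < h -> h < 1 -> slow_ratio lam h ->
  (1 - h) ^+ 2 * \sum_(0 <= k < n.+1) weighted_mean lam u k ^+ 2
    + (sum_ratio lam n * (1 - h) + h - (1 - h) ^+ 2)
      * weighted_mean lam u n ^+ 2
  <= \sum_(0 <= k < n.+1) u k ^+ 2.
Proof.
move=> lam_gt0 h0 h1 slow; elim: n => [|n IH].
  rewrite !big_nat1 weighted_mean0 // /sum_ratio /partial_sum big_nat1.
  rewrite divff ?gt_eqF //; lra.
have b1 := sum_ratio_ge1 _ lam n.+1 lam_gt0.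
have := weight_step _ h _ _ h0 h1 b1 (slow n).
move/(energy_step _ _ _ _ (weighted_mean lam u n.+1) (weighted_mean lam u n)
        h0 b1).
rewrite weighted_mean_rec // => step.
rewrite (big_nat_recr n.+1) //= [leRHS](big_nat_recr n.+1) //=.
lra.
Qed.

Lemma weighted_mean_l2 (R : realType) (lam u : nat -> R) (h : R) n :
  (forall n, 0 < lam n) -> 0 < h -> h < 1 -> slow_ratio lam h ->
  (1 - h) ^+ 2 * \sum_(0 <= k < n) weighted_mean lam u k ^+ 2
    <= \sum_(0 <= k < n) u k ^+ 2.
Proof.
move=> lam_gt0 h0 h1 slow.
case: n => [|n]; first by rewrite !big_geq // mulr0.
apply: le_trans (weighted_mean_energy _ _ u h n lam_gt0 h0 h1 slow).
rewrite lerDl mulr_ge0 ?sqr_ge0 //.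
have := sum_ratio_ge1 _ lam n lam_gt0.
nra.
Qed.

(** * Triangular matrices acting on complex sequences *)

Section ComplexSequences.
Local Open Scope complex_scope.

Lemma Re_sum (R : realType) (f : nat -> R[i]) m n :
  complex.Re (\sum_(m <= k < n) f k) = \sum_(m <= k < n) complex.Re (f k).
Proof. by apply: (big_morph (@complex.Re R)) => // -[? ?] [? ?]. Qed.

Lemma Im_sum (R : realType) (f : nat -> R[i]) m n :
  complex.Im (\sum_(m <= k < n) f k) = \sum_(m <= k < n) complex.Im (f k).
Proof. by apply: (big_morph (@complex.Im R)) => // -[? ?] [? ?]. Qed.

Lemma Re_norm_sqr (R : realType) (z : Cplx R) :
  complex.Re `|z| ^+ 2 = complex.Re z ^+ 2 + complex.Im z ^+ 2.
Proof. by rewrite normc_def /= sqr_sqrtr // addr_ge0 ?sqr_ge0. Qed.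

(** The series defining an entry of the image under a lower triangular matrix
    is eventually constant, hence convergent, whatever the sequence. *)
Lemma mxterm_series_near (R : realType) (C : nat -> nat -> Cplx R)
    (x : nat -> Cplx R) n :
  (forall k, (n < k)%N -> C n k = 0) ->
  \forall m \near eventually,
    series (mxterm C x n) m = \sum_(0 <= k < n.+1) mxterm C x n k.
Proof.
move=> C0; exists n.+1 => // m /= nm.
rewrite /series /= (big_cat_nat (n := n.+1)) //=.
rewrite [X in _ + X]big1_seq ?addr0 // => k /andP[_].
rewrite mem_index_iota => /andP[nk _].
by rewrite /mxterm C0 // mul0r.
Qed.

Lemma weighted_mean_mx_tri (R : realType) (lam : nat -> R) n k :
  (n < k)%N -> weighted_mean_mx lam n k = 0.
Proof. by rewrite /weighted_mean_mx ltnNge => /negbTE ->. Qed.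

Lemma mxact_weighted_mean (R : realType) (lam : nat -> R) (x : nat -> Cplx R)
    n :
  mxact (weighted_mean_mx lam) x n =
  weighted_mean lam (fun k => complex.Re (x k)) n +i*
  weighted_mean lam (fun k => complex.Im (x k)) n.
Proof.
have -> : mxact (weighted_mean_mx lam) x n =
    \sum_(0 <= k < n.+1) mxterm (weighted_mean_mx lam) x n k.
  apply: norm_lim_near_cst; apply: mxterm_series_near => k.
  exact: weighted_mean_mx_tri.
apply/eqP; rewrite eq_complex Re_sum Im_sum /= /weighted_mean !mulr_suml.
apply/andP; split; apply/eqP; apply: eq_big_nat => k /andP[_ kn];
  rewrite /mxterm /weighted_mean_mx -ltnS kn; case: (x k) => a b /=;
  rewrite mul0r ?subr0 ?addr0; ring.
Qed.

End ComplexSequences.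

(** * The l2 norm and finite partial sums *)

Section L2Norm.
Local Open Scope ereal_scope.

Lemma l2norm_le_of_partial (R : realType) (x : nat -> Cplx R) (q : R) :
  (0 <= q)%R ->
  (forall n, (\sum_(0 <= k < n) complex.Re `|x k| ^+ 2 <= q ^+ 2)%R) ->
  l2norm x <= q%:E.
Proof.
move=> q0 H; rewrite /l2norm.
have p n : 0 <= (complex.Re `|x n| ^+ 2)%:E by rewrite lee_fin sqr_ge0.
have S0 : 0 <= \sum_(0 <= n <oo) (complex.Re `|x n| ^+ 2)%:E.
  exact: nneseries_ge0.
have -> : q%:E = (q ^+ 2)%:E `^ 2^-1.
  by rewrite poweR12_sqrt ?lee_fin ?sqr_ge0 //= sqrtr_sqr ger0_norm.
apply: gt0_ler_poweR;
  rewrite ?invr_ge0 // ?in_itv /= ?S0 ?lee_fin ?sqr_ge0 ?leey //.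
apply: lime_le; first by apply: is_cvg_nneseries => k _ _; apply: p.
by apply: nearW => n; rewrite sumEFin lee_fin; apply: H.
Qed.

Lemma l2norm_eq1_partial (R : realType) (x : nat -> Cplx R) n :
  l2norm x = 1 -> (\sum_(0 <= k < n) complex.Re `|x k| ^+ 2 <= 1)%R.
Proof.
have p k : 0 <= (complex.Re `|x k| ^+ 2)%:E by rewrite lee_fin sqr_ge0.
rewrite /l2norm => /(congr1 (fun t => t `^ 2)).
rewrite poweR1r -poweRrM mulVf // poweRe1; last exact: nneseries_ge0.
move=> S1; rewrite -lee_fin -S1 -sumEFin.
exact: nneseries_lim_ge.
Qed.

End L2Norm.

Theorem corollary1p3 (R : realType) (lam : nat -> R) (L : R)
  (lam_gt0 : forall n, 0 < lam n) (L_gt0 : 0 < L) (L_lt2 : L < 2)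
  (hL : forall n : nat,
     partial_sum lam n.+1 / lam n.+1 - partial_sum lam n / lam n
     <= L + L ^+ 2 / 4 * ((1 + L / 2) / (1 - L / 2))
          * (1 / (partial_sum lam n.+1 / lam n.+1 + L / 2))) :
  (opnorm22 (weighted_mean_mx lam) <= (2 / (2 - L))%:E)%E.
Proof.
have h0 : 0 < L / 2 by lra.
have h1 : L / 2 < 1 by lra.
have c0 : 0 < 1 - L / 2 by lra.
have slow : slow_ratio lam (L / 2).
  by move=> n; have := hL n; rewrite mul1r; congr (_ <= _ + _ * _ * _); lra.
have -> : 2 / (2 - L) = (1 - L / 2)^-1 by field; lra.
apply: ge_ereal_sup => _ [x /= x1 <-]; rewrite /mxact_l2norm asboolT; last first.
  move=> n; apply: is_cvg_near_cst (mxterm_series_near _ _ _ _ _) => k.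
  exact: weighted_mean_mx_tri.
apply: l2norm_le_of_partial => [|n]; first by rewrite invr_ge0 ltW.
rewrite exprVn -(mul1r (_ ^-1)) ler_pdivlMr ?exprn_gt0 // mulrC.
apply: le_trans (l2norm_eq1_partial _ _ n x1).
under eq_bigr do rewrite mxact_weighted_mean Re_norm_sqr /=.
under [leRHS]eq_bigr do rewrite Re_norm_sqr.
by rewrite !big_split mulrDr lerD //; apply: weighted_mean_l2.
Qed.
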